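(* For every real $x$ and every integer $n\ge 0$, $$d_{n,\lambda}^{Y}(x)=\sum_{l=0}^{n}\binom{n}{l}d_{l,\lambda}^{Y}\,(x)_{n-l,\lambda}=n!\sum_{k=0}^{n}\frac{E[(x-Y)_{k,\lambda}]}{k!}.$$
   Context: Let $\lambda$ be a nonzero real number. Set $(x)_{0,\lambda}=1$ and $(x)_{k,\lambda}=x(x-\lambda)\cdots(x-(k-1)\lambda)$ for $k\ge 1$. The degenerate exponential is $e_{\lambda}^{x}(t)=\sum_{k\ge 0}(x)_{k,\lambda}\frac{t^{k}}{k!}$ (so $e_\lambda^x(t)=(1+\lambda t)^{x/\lambda}$ for $t$ near $0$). $Y$ is a real random variable whose moment generating function $E[e^{tY}]=\sum_{n\ge 0}E[Y^n]\frac{t^n}{n!}$ exists for $|t|<r$, for some $r>0$. $E$ denotes expectation. The probabilistic degenerate derangement polynomials associated with $Y$, $d_{n,\lambda}^{Y}(x)$, are defined by $$\frac{1}{1-t}E\big[e_{\lambda}^{x-Y}(t)\big]=\sum_{n=0}^{\infty}d_{n,\lambda}^{Y}(x)\frac{t^{n}}{n!}$$ (power series in $t$ near $0$), and $d_{n,\lambda}^{Y}=d_{n,\lambda}^{Y}(0)$. In the claim, $d_{l,\lambda}^{Y}\,(x)_{n-l,\lambda}$ is the product of the number $d_{l,\lambda}^{Y}$ and $(x)_{n-l,\lambda}$. *)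

(* Defs.v *)
From mathcomp Require Import all_boot all_order all_algebra.
From mathcomp Require Import all_classical all_reals all_analysis.
Import Order.TTheory GRing.Theory Num.Theory.
Import numFieldNormedType.Exports.

Set Implicit Arguments.
Unset Strict Implicit.
Unset Printing Implicit Defensive.

Local Open Scope classical_set_scope.
Local Open Scope ring_scope.

Definition degen_ffact (R : realType) (lambda x : R) (k : nat) : R :=
  \prod_(i < k) (x - i%:R * lambda).

(* The series converges for `|lambda * t| < 1, which is all that is used:
   below, t only ranges over a neighbourhood of 0. *)
Definition degen_exp (R : realType) (lambda x t : R) : R :=
  limn (pseries (fun k => degen_ffact lambda x k / k`!%:R) t).

(* f(t) = \sum_n a_n t^n / n! for t near 0, where f is extended-real valued
   because expectations are; finiteness of f near 0 is part of the notion. *)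
Definition has_egf (R : realType) (a : nat -> R) (f : R -> \bar R) : Prop :=
  \forall t \near (0 : R), f t \is a fin_num /\
    pseries (fun n => a n / n`!%:R) t @ \oo --> fine (f t).

(* There is at most one such sequence, by uniqueness of power series
   coefficients; the value is arbitrary when f has no expansion at 0. *)
Definition egf_coef (R : realType) (f : R -> \bar R) : nat -> R :=
  get [set a : nat -> R | has_egf a f].

Definition derangement_gf (d : measure_display) (T : measurableType d)
    (R : realType) (P : probability T R) (Y : {RV P >-> R}) (lambda x t : R)
    : \bar R :=
  (((1 - t)^-1)%:E * 'E_P[fun w => degen_exp lambda (x - Y w) t])%E.

Definition derangement_poly (d : measure_display) (T : measurableType d)
    (R : realType) (P : probability T R) (Y : {RV P >-> R}) (lambda : R)
    (n : nat) (x : R) : R :=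
  egf_coef (derangement_gf Y lambda x) n.

Definition derangement_number (d : measure_display) (T : measurableType d)
    (R : realType) (P : probability T R) (Y : {RV P >-> R}) (lambda : R)
    (n : nat) : R :=
  derangement_poly Y lambda n 0.

(* Main.v *)
Require Import Defs.
From mathcomp Require Import all_boot all_order all_algebra.
From mathcomp Require Import all_classical all_reals all_analysis.
From mathcomp Require Import measurable_realfun ring lra.
Import Order.TTheory GRing.Theory Num.Theory.
Import numFieldNormedType.Exports.
Local Open Scope ring_scope.

(** Write [c_k(y)] for the Taylor coefficient [(y)_{k,lambda} / k!] of the
    degenerate exponential and [m_k(x)] for its mean [E[c_k(x - Y)]]. Everything
    follows from the closed form [d_n(x) = n! (m_0(x) + ... + m_n(x))]
    ([derangement_polyE]), which is the second identity.

    The closed form rests on exchanging expectation and summation in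
    [E[sum_k c_k(x - Y) t^k]] for small [t] ([expectation_degen_exp]). Since
    [|(y)_{k,lambda}| <= (|y| + k |lambda|)^k] and [z^k / k! <= exp z], for each
    [e > 0] one has [|c_k(y)| <= exp (e |y|) K^k] with [K] depending only on [e]
    and [lambda] ([degen_coef_growth]). So for [|t| K <= 1/2] all partial sums
    are dominated by [2 exp (e |x - Y|)], which is integrable as soon as [e < r]
    ([integrable_expR_abs]), and dominated convergence applies. The factor
    [1 / (1 - t)] turns the coefficients [m_k] into their partial sums
    ([pseries_partial_sums]), and the coefficients of a power series are
    determined by its values near 0 ([egf_coefE]), so these partial sums, times
    [n!], are the numbers that the definition of [d_n(x)] selects.

    For the first identity, the Vandermonde rule
    [c_k(x - Y) = sum_j c_j(- Y) c_(k-j)(x)] ([degen_coefD]) makes [m(x)] the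
    convolution of [m(0)] with [c(x)]. Partial sums of a convolution are the
    convolution of the partial sums of one factor with the other
    ([sum_convolution]). *)

Set Implicit Arguments.
Unset Strict Implicit.

(** * Coefficients of the degenerate exponential *)

Definition degen_coef (R : realType) (lambda x : R) (k : nat) : R :=
  degen_ffact lambda x k / k`!%:R.

Lemma degen_coef0 (R : realType) (lambda x : R) : degen_coef lambda x 0 = 1.
Proof. by rewrite /degen_coef /degen_ffact big_ord0 divr1. Qed.

Lemma degen_coefS (R : realType) (lambda x : R) k :
  k.+1%:R * degen_coef lambda x k.+1 =
  (x - k%:R * lambda) * degen_coef lambda x k.
Proof.
rewrite /degen_coef /degen_ffact big_ord_recr /= factS natrM.
have k1 : k.+1%:R != 0 :> R by rewrite pnatr_eq0.
have kf : k`!%:R != 0 :> R by rewrite pnatr_eq0 -lt0n fact_gt0.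
move: (k.+1%:R) k1 (k`!%:R) kf => a a0 b b0.
by field; rewrite a0 b0.
Qed.

(** The coefficient of [t^k] in [(1 + lambda t)^((x + y) / lambda)], a product
    of two powers; the recurrence [degen_coefS] characterises both sides. *)
Lemma degen_coefD (R : realType) (lambda x y : R) k :
  degen_coef lambda (x + y) k =
  \sum_(j < k.+1) degen_coef lambda x j * degen_coef lambda y (k - j).
Proof.
elim: k => [|k IHk].
  by rewrite big_ord_recl big_ord0 !degen_coef0 mulr1 addr0.
have k1 : k.+1%:R != 0 :> R by rewrite pnatr_eq0.
apply: (mulfI k1); rewrite degen_coefS IHk !mulr_sumr.
set f := degen_coef lambda x; set g := degen_coef lambda y.
(* The weight k + 1 of each term splits as j + (k + 1 - j); the recurrence is
   applied to the first factor in one half and to the second in the other. *)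
transitivity (\sum_(j < k.+2) (j%:R * f j * g (k.+1 - j)%N
                   + f j * ((k.+1 - j)%:R * g (k.+1 - j)%N))); last first.
  apply: eq_bigr => j _.
  have -> : k.+1%:R = j%:R + (k.+1 - j)%:R :> R.
    by rewrite -natrD subnKC // -ltnS.
  by ring.
rewrite big_split /= [X in _ = X + _]big_ord_recl /= !mul0r add0r.
rewrite [X in _ = _ + X]big_ord_recr /= subnn mul0r mulr0 addr0 -big_split /=.
apply: eq_bigr => j _; rewrite /bump /= add1n subSS.
have jk : (j <= k)%N by rewrite -ltnS.
rewrite degen_coefS subSn // degen_coefS -/f -/g natrB //.
by ring.
Qed.

(** With generating functions, this is associativity of the product of
    [1 / (1 - t)] with those of [b] and [c]. *)
Lemma sum_convolution (R : comNzRingType) (b c : nat -> R) n :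
  \sum_(k < n.+1) \sum_(j < k.+1) b j * c (k - j)%N =
  \sum_(l < n.+1) (\sum_(j < l.+1) b j) * c (n - l)%N.
Proof.
elim: n => [|n IHn].
  by rewrite !big_ord1.
rewrite big_ord_recr /= IHn [RHS]big_ord_recl /= big_ord1 subn0.
under [in RHS]eq_bigr => l _.
  rewrite /bump /= add1n subSS big_ord_recr /= mulrDl.
  over.
rewrite big_split /= [X in _ + X = _]big_ord_recl /= subn0.
under [in X in _ + X = _]eq_bigr => j _ do rewrite /bump /= add1n subSS.
by ring.
Qed.

(** * Power series and their coefficients *)

Local Open Scope classical_set_scope.

Lemma sum_geometric_half_le2 (R : realFieldType) (s : R) n :
  0 <= s -> s <= 2^-1 -> \sum_(0 <= i < n) s ^+ i <= 2.
Proof.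
move=> s0 s2; elim: n => [|n IHn]; first by rewrite big_nil.
rewrite big_nat_recl // expr0.
under eq_bigr => i _ do rewrite exprS.
rewrite -mulr_sumr.
have S0 : 0 <= \sum_(0 <= i < n) s ^+ i.
  by apply: sumr_ge0 => i _; exact: exprn_ge0.
have := ler_pM s0 S0 s2 IHn.
by rewrite mulVf // => h; rewrite -[2]/(1 + 1) lerD2l.
Qed.

Lemma pseries_terms_bounded (R : realType) (c : nat -> R) (rho : R) :
  cvgn (pseries c rho) -> exists M : R, forall n, `|c n * rho ^+ n| <= M.
Proof.
move=> /cvg_series_bounded [K [_ HK]].
by exists (K + 1) => n; apply: HK => //; rewrite ltrDl.
Qed.

(** Terms are bounded by some [M] at a point [rho], so at [s * rho] the series
    without its constant term is at most [2 M s]; let [s] tend to 0. The value at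
    0 itself is left out of the hypothesis so that the lemma can be applied again
    after a division by [t]. *)
Lemma pseries_cvg0_coef0 (R : realType) (c : nat -> R) :
  (\forall t \near 0^', pseries c t @ \oo --> (0 : R)) -> c 0%N = 0.
Proof.
move=> /nbhs_ballP[e /= e0 He].
pose rho := e / 2.
have rho0 : 0 < rho by rewrite divr_gt0.
have inball t : 0 < t -> t <= rho -> pseries c t @ \oo --> (0 : R).
  move=> t0 trho.
  have bt : ball 0 e t.
    rewrite /ball /= sub0r normrN gtr0_norm //; apply: le_lt_trans trho _.
    by rewrite /rho; lra.
  exact: (He t bt (lt0r_neq0 t0)).
have [M HM] : exists M : R, forall n, `|c n * rho ^+ n| <= M.
  apply: pseries_terms_bounded; apply/cvg_ex; exists 0.
  exact: inball.
have M0 : 0 <= M by apply: le_trans (HM 0%N).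
have key s : 0 < s -> s <= 2^-1 -> `|c 0%N| <= 2 * M * s.
  move=> s0 s2; apply/ler_addgt0Pr => eps eps0.
  have trho : s * rho <= rho by rewrite ler_piMl // ?(ltW rho0) //; lra.
  have := inball _ (mulr_gt0 s0 rho0) trho.
  rewrite -cvg_shiftS => /cvgrPdist_lt /(_ eps eps0) [N _ /(_ N (leqnn N))] /=.
  rewrite sub0r normrN /pseries /= /series /= big_nat_recl //= expr0 mulr1.
  set S := \sum_(0 <= i < N) _ => cS.
  have SM : `|S| <= 2 * M * s.
    apply: (le_trans (ler_norm_sum _ _ _)).
    apply: (@le_trans _ _ (\sum_(0 <= i < N) (M * s) * s ^+ i)).
      apply: ler_sum => i _.
      have s1 : 0 <= s ^+ i.+1 by rewrite exprn_ge0 // ltW.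
      rewrite exprMn mulrCA mulrC normrM (ger0_norm s1) -mulrA -exprS.
      exact: ler_wpM2r.
    rewrite -mulr_sumr -(mulrA 2) (mulrC 2).
    apply: ler_wpM2l; first by rewrite mulr_ge0 // ltW.
    by apply: sum_geometric_half_le2 => //; exact: ltW.
  have -> : c 0%N = (c 0%N + S) - S by rewrite addrK.
  apply: (le_trans (ler_normB _ _)); rewrite addrC; apply: lerD => //.
  exact: ltW.
apply/eqP; rewrite -normr_le0; apply/ler_addgt0Pr => eps eps0; rewrite add0r.
pose s := Order.min 2^-1 (eps / (2 * M + 1)).
have s0 : 0 < s.
  by rewrite lt_min invr_gt0 ltr0n divr_gt0 // ltr_wpDl // mulr_ge0.
apply: (le_trans (key s s0 _)); first by rewrite ge_min lexx.
have : s <= eps / (2 * M + 1) by rewrite ge_min lexx orbT.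
rewrite ler_pdivlMr; last by rewrite ltr_wpDl // mulr_ge0.
by apply: le_trans; rewrite mulrC ler_wpM2l ?ltW // ltrDl.
Qed.

(** Once the constant term vanishes, dividing by [t] shifts the coefficients. *)
Lemma pseries_cvg0_eq0 (R : realType) (c : nat -> R) :
  (\forall t \near 0^', pseries c t @ \oo --> (0 : R)) -> forall n, c n = 0.
Proof.
move=> Hc n; elim: n c Hc => [|n IHn] c Hc; first exact: pseries_cvg0_coef0.
have c0 := pseries_cvg0_coef0 Hc.
apply: (IHn (fun i => c i.+1)).
have t_neq0 : \forall t \near (0 : R)^', t != 0 by exact: nbhs_dnbhs_neq.
near=> t.
have t0 : t != 0 by near: t.
have : pseries c t @ \oo --> (0 : R) by near: t.
rewrite -cvg_shiftS => /(cvgMr_tmp (b := t^-1)); rewrite mul0r.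
apply: cvg_trans; apply: near_eq_cvg; apply: nearW => m.
rewrite /pseries /series /= big_nat_recl // c0 mul0r add0r mulr_suml.
by apply: eq_bigr => i _; rewrite exprSr !mulrA mulfK.
Unshelve. all: by end_near. Qed.

Lemma has_egf_unique (R : realType) (a b : nat -> R) (f : R -> \bar R) :
  has_egf a f -> has_egf b f -> a = b.
Proof.
move=> Ha Hb; apply/funext => n.
have /pseries_cvg0_eq0/(_ n) : \forall t \near (0 : R)^',
    pseries (fun n => (a n - b n) / n`!%:R) t @ \oo --> (0 : R).
  apply: nbhs_dnbhs; apply: filterS2 Ha Hb => t [_ Ha] [_ Hb].
  rewrite -(subrr (fine (f t))) (_ : pseries _ t =
    pseries (fun n => a n / n`!%:R) t - pseries (fun n => b n / n`!%:R) t).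
    exact: cvgB.
  apply/funext => m; rewrite /pseries /series /= !fctE -sumrB.
  by apply: eq_bigr => i _; rewrite mulrBl mulrBl.
move=> /eqP; rewrite mulf_eq0 invr_eq0 pnatr_eq0 -[(n`! == 0)%N]negbK -lt0n.
by rewrite fact_gt0 orbF subr_eq0 => /eqP.
Qed.

Lemma egf_coefE (R : realType) (a : nat -> R) (f : R -> \bar R) :
  has_egf a f -> egf_coef f = a.
Proof.
by move=> Ha; apply: get_unique => // b Hb; exact: (has_egf_unique Hb Ha).
Qed.

(** Multiplication of a generating function by [1 / (1 - t)]. The geometric bound
    on [b] makes the remainder [(b_0 + ... + b_(n-1)) t^n] tend to 0; taking [K]
    at least 2 keeps the partial sums under the bound [M K^n] as well. *)
Lemma pseries_partial_sums (R : realType) (b : nat -> R) (M K t s : R) :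
  2 <= K -> (forall k, `|b k| <= M * K ^+ k) -> `|t| * K < 1 ->
  pseries b t @ \oo --> s ->
  pseries (fun n => \sum_(k < n.+1) b k) t @ \oo --> (1 - t)^-1 * s.
Proof.
move=> K2 bM tK bs.
have t1 : `|t| < 1.
  by apply: le_lt_trans tK; rewrite ler_peMr //;
    apply: le_trans K2; rewrite ler1n.
have t1' : 1 - t != 0.
  by rewrite subr_eq0; apply: contraTneq t1 => <-; rewrite normr1 ltxx.
have AM n : `|\sum_(k < n) b k| <= M * K ^+ n.
  have M0 : 0 <= M by have := le_trans (normr_ge0 _) (bM 0%N); rewrite mulr1.
  apply: (le_trans (ler_norm_sum _ _ _)).
  elim: n => [|n IHn]; first by rewrite big_ord0 mulr1.
  rewrite big_ord_recr /= exprS; apply: (le_trans (lerD IHn (bM n))).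
  rewrite -mulr2n -mulr_natr -mulrA ler_wpM2l // mulrC ler_wpM2r //.
  by rewrite exprn_ge0 // (le_trans _ K2).
have A0 : (fun n => (\sum_(k < n) b k) * t ^+ n) @ \oo --> (0 : R).
  apply/norm_cvg0P.
  have gK : geometric M (`|t| * K) @ \oo --> (0 : R).
    apply: cvg_geometric; rewrite ger0_norm // mulr_ge0 //.
    exact: le_trans K2.
  apply: (squeeze_cvgr _ (cvg_cst 0) gK).
  apply: nearW => n; rewrite normr_ge0 /= normrM normrX exprMn.
  rewrite [X in _ <= _ * X]mulrC mulrA ler_wpM2r //; exact: AM.
rewrite (_ : pseries _ t = fun N => (1 - t)^-1 *
  (pseries b t N - (\sum_(k < N) b k) * t ^+ N)); last first.
  apply/funext => N; apply: (mulfI t1'); rewrite mulVKf //.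
  (* Multiplying by 1 - t telescopes the sums of the b k back into b, up to the
     last one. *)
  elim: N => [|N IHN].
    by rewrite /pseries /series /= !big_nil big_ord0 mul0r subr0 mulr0.
  move: IHN; rewrite /pseries /series /= !big_nat_recr //= mulrDr => ->.
  by rewrite [\sum_(k < N.+1) _]big_ord_recr /= exprS; ring.
by rewrite -[s]subr0; apply: cvgMl_tmp; exact: cvgB.
Qed.

(** * Domination of the degenerate exponential series *)

Lemma exprn_div_fact_le_expR (R : realType) (z : R) k :
  0 <= z -> z ^+ k / k`!%:R <= expR z.
Proof.
move=> z0; case: k => [|k]; first by rewrite expr0 divr1 -expR0 ler_expR.
by apply: le_trans (expR_ge1Dxn k z0); rewrite lerDr.
Qed.

(** The exponential type [e] in [y] can be made as small as desired, at the cost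
    of a larger ratio [K]: this is what lets any moment generating function,
    however small its domain, control the expectations of all the coefficients.
    The ratio is [exp (e |lambda|) / e], raised to 2 for
    [pseries_partial_sums]. *)
Lemma degen_coef_growth (R : realType) (lambda e : R) : 0 < e ->
  exists2 K : R, 2 <= K &
  forall y k, `|degen_coef lambda y k| <= expR (e * `|y|) * K ^+ k.
Proof.
move=> e0; exists (Order.max 2 (expR (e * `|lambda|) / e)).
  by rewrite le_max lexx.
move=> y k; set K := Order.max _ _.
have eK : expR (e * `|lambda|) <= e * K.
  by rewrite [e * K]mulrC -ler_pdivrMr // /K le_max lexx orbT.
have eneq0 := lt0r_neq0 e0.
(* [z] dominates each factor of [(y)_{k,lambda}]; [z^k / k! <= exp z] is used at
   [e * z], which costs the factor [e^-k]. *)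
pose z := `|y| + k%:R * `|lambda|.
have z0 : 0 <= z by rewrite addr_ge0 // mulr_ge0.
have -> : degen_coef lambda y k = degen_ffact lambda y k / k`!%:R by [].
apply: (@le_trans _ _ ((e * z) ^+ k / k`!%:R / e ^+ k)).
  rewrite normrM [X in _ * X]ger0_norm ?invr_ge0 // exprMn.
  rewrite mulrAC [_ * z ^+ k]mulrC mulfK ?expf_neq0 //.
  apply: ler_wpM2r; first by rewrite invr_ge0.
  rewrite /degen_ffact normr_prod.
  apply: (@le_trans _ _ (\prod_(i < k) z)); last first.
    by rewrite prodr_const card_ord.
  apply: ler_prod => i _; rewrite normr_ge0 /=.
  apply: (le_trans (ler_normB _ _)); rewrite lerD2l normrM normr_nat.
  by apply: ler_wpM2r => //; rewrite ler_nat ltnW.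
rewrite ler_pdivrMr ?exprn_gt0 //.
apply: (le_trans (exprn_div_fact_le_expR _ _)).
  by rewrite mulr_ge0 // ltW.
rewrite -mulrA -exprMn [K * e]mulrC mulrDr expRD ler_wpM2l ?expR_ge0 //.
rewrite mulrCA expRM_natl; apply: lerXn2r => //; rewrite nnegrE ?expR_ge0 //.
exact: le_trans (expR_ge0 _) eK.
Qed.

Lemma pseries_half_ratio_le (R : realType) (c : nat -> R) (M K t : R) N :
  0 <= M -> 0 <= K -> (forall k, `|c k| <= M * K ^+ k) -> `|t| * K <= 2^-1 ->
  `|pseries c t N| <= 2 * M.
Proof.
move=> M0 K0 cM tK; rewrite /pseries /series /=.
apply: (le_trans (ler_norm_sum _ _ _)).
apply: (@le_trans _ _ (\sum_(0 <= i < N) M * (`|t| * K) ^+ i)).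
  apply: ler_sum => i _; rewrite normrM normrX exprMn.
  by rewrite [X in _ <= _ * X]mulrC mulrA ler_wpM2r // exprn_ge0.
rewrite -mulr_sumr mulrC ler_wpM2r //.
by apply: sum_geometric_half_le2 => //; exact: mulr_ge0.
Qed.

Lemma is_cvg_pseries_ratio (R : realType) (c : nat -> R) (M K t : R) :
  0 <= M -> 0 <= K -> (forall k, `|c k| <= M * K ^+ k) -> `|t| * K < 1 ->
  cvgn (pseries c t).
Proof.
move=> M0 K0 cM tK; have tK0 : 0 <= `|t| * K by rewrite mulr_ge0.
apply: normed_cvg; apply: (@series_le_cvg _ _ (geometric M (`|t| * K))) => //.
- by move=> n; exact: normr_ge0.
- by move=> n; apply: mulr_ge0 => //; exact: exprn_ge0.
- move=> n; rewrite /= normrM normrX exprMn.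
  by rewrite [X in _ <= _ * X]mulrC mulrA ler_wpM2r // exprn_ge0.
- by apply: is_cvg_geometric_series; rewrite ger0_norm.
Qed.

Lemma integrable_expR_mgf (R : realType) (d : measure_display)
    (T : measurableType d) (P : probability T R) (Y : {RV P >-> R}) (t : R) :
  ('M_P Y t \is a fin_num)%E ->
  P.-integrable setT (EFin \o (fun w => expR (Y w * t))).
Proof.
rewrite /mmt_gen_fun unlock fin_numE => /andP[_ fin].
apply/integrableP; split.
  apply/measurable_EFinP; apply: measurableT_comp => //.
  exact: measurable_funM.
under eq_integral => w _ do rewrite /= ger0_norm ?expR_ge0 //.
by rewrite ltey.
Qed.

(** [exp (e |y|) <= exp (e y) + exp (- e y)], and both terms on the right are
    integrable at [y = Y]. *)
Lemma integrable_expR_abs (R : realType) (d : measure_display)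
    (T : measurableType d) (P : probability T R) (Y : {RV P >-> R}) (r e x : R) :
  (forall t : R, `|t| < r -> ('M_P Y t \is a fin_num)%E) ->
  0 < e -> e < r ->
  P.-integrable setT (EFin \o (fun w => expR (e * `|x - Y w|))).
Proof.
move=> mgfY e0 er.
have ip : P.-integrable setT (EFin \o (fun w => expR (Y w * e))).
  by apply/integrable_expR_mgf/mgfY; rewrite gtr0_norm.
have im : P.-integrable setT (EFin \o (fun w => expR (Y w * - e))).
  by apply/integrable_expR_mgf/mgfY; rewrite normrN gtr0_norm.
have := integrableZl measurableT (expR (e * `|x|))
  (integrableD measurableT ip im).
apply: le_integrable => //.
  apply/measurable_EFinP; apply: measurableT_comp => //.
  apply: measurable_funM => //; apply: measurableT_comp => //.
  exact: measurable_funB.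
move=> w _ /=; rewrite lee_fin (ger0_norm (expR_ge0 _)).
apply: (le_trans _ (ler_norm _)).
apply: (@le_trans _ _ (expR (e * `|x|) * expR (e * `|Y w|))).
  by rewrite -expRD ler_expR -mulrDr ler_pM2l // ler_normB.
rewrite ler_pM2l ?expR_gt0 //.
have [Y0|Y0] := leP 0 (Y w); first by rewrite ger0_norm // mulrC lerDl expR_ge0.
by rewrite ltr0_norm // mulrC mulNr -mulrN lerDr expR_ge0.
Qed.

(** * Expectation of the degenerate exponential *)

Definition mean_degen_coef (R : realType) (d : measure_display)
    (T : measurableType d) (P : probability T R) (Y : {RV P >-> R})
    (lambda x : R) (k : nat) : R :=
  fine 'E_P[fun w => degen_coef lambda (x - Y w) k].

Lemma measurable_degen_coef (R : realType) (d : measure_display)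
    (T : measurableType d) (P : probability T R) (Y : {RV P >-> R})
    (lambda x : R) k :
  measurable_fun setT (fun w => degen_coef lambda (x - Y w) k).
Proof.
apply: measurable_funM => //; apply: measurable_prod => i _.
by apply: measurable_funB => //; exact: measurable_funB.
Qed.

Lemma integrable_degen_coef (R : realType) (d : measure_display)
    (T : measurableType d) (P : probability T R) (Y : {RV P >-> R})
    (r lambda x : R) k :
  0 < r -> (forall t : R, `|t| < r -> ('M_P Y t \is a fin_num)%E) ->
  P.-integrable setT (EFin \o (fun w => degen_coef lambda (x - Y w) k)).
Proof.
move=> r0 mgfY; pose e := r / 2.
have e0 : 0 < e by rewrite divr_gt0.
have er : e < r by rewrite /e; lra.
have [K K2 Kgrowth] := degen_coef_growth lambda e0.
have := integrableZl measurableT (K ^+ k) (integrable_expR_abs x mgfY e0 er).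
apply: le_integrable => //.
  by apply/measurable_EFinP; exact: measurable_degen_coef.
move=> w _ /=; rewrite lee_fin mulrC; apply: (le_trans _ (ler_norm _)).
exact: Kgrowth.
Qed.

Lemma integral_degen_coef (R : realType) (d : measure_display)
    (T : measurableType d) (P : probability T R) (Y : {RV P >-> R})
    (r lambda x : R) k :
  0 < r -> (forall t : R, `|t| < r -> ('M_P Y t \is a fin_num)%E) ->
  (\int[P]_w (degen_coef lambda (x - Y w) k)%:E)%E =
  (mean_degen_coef Y lambda x k)%:E.
Proof.
move=> r0 mgfY; rewrite /mean_degen_coef unlock fineK //.
exact: (integrable_fin_num measurableT
  (integrable_degen_coef lambda x k r0 mgfY)).
Qed.

(** Dominated convergence, with dominating function [2 exp (e |x - Y|)] for some
    [e < r]. The growth of the mean coefficients is recorded with the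
    expansion because both come from the same constants. *)
Lemma expectation_degen_exp (R : realType) (d : measure_display)
    (T : measurableType d) (P : probability T R) (Y : {RV P >-> R})
    (r lambda x : R) :
  0 < r -> (forall t : R, `|t| < r -> ('M_P Y t \is a fin_num)%E) ->
  exists M K : R, [/\ 2 <= K,
    forall k, `|mean_degen_coef Y lambda x k| <= M * K ^+ k &
    forall t, `|t| * K <= 2^-1 ->
      let E := ('E_P[fun w => degen_exp lambda (x - Y w) t])%E in
      (E \is a fin_num)%E /\
      pseries (mean_degen_coef Y lambda x) t @ \oo --> fine E].
Proof.
move=> r0 mgfY; pose e := r / 2.
have e0 : 0 < e by rewrite divr_gt0.
have er : e < r by rewrite /e; lra.
have [K K2 Kgrowth] := degen_coef_growth lambda e0.
have K0 : 0 <= K by exact: le_trans K2.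
pose g w := expR (e * `|x - Y w|).
have g0 w : 0 <= g w by exact: expR_ge0.
have ig : P.-integrable setT (EFin \o g) := integrable_expR_abs x mgfY e0 er.
have igk k := integrable_degen_coef lambda x k r0 mgfY.
have bound w k : `|degen_coef lambda (x - Y w) k| <= g w * K ^+ k.
  exact: Kgrowth.
have mE k := integral_degen_coef lambda x k r0 mgfY.
have gE : (\int[P]_w (g w)%:E)%E = (fine (\int[P]_w (g w)%:E)%E)%:E.
  by rewrite fineK //; exact: (integrable_fin_num measurableT ig).
pose M := fine (\int[P]_w (g w)%:E)%E.
have M0 : 0 <= M.
  by apply: fine_ge0; apply: integral_ge0 => w _; rewrite lee_fin.
have mM k : `|mean_degen_coef Y lambda x k| <= M * K ^+ k.
  rewrite -lee_fin EFinM -gE.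
  rewrite -[leLHS]/(`|(mean_degen_coef Y lambda x k)%:E|)%E -mE.
  apply: (le_trans (le_abse_integral _ measurableT _)).
    by exact: (measurable_int _ (igk k)).
  rewrite -integralZr //; apply: ge0_le_integral => //.
  - apply: measurableT_comp => //; first by exact: (measurable_int _ (igk k)).
  - by apply: emeasurable_funM => //; exact: (measurable_int _ ig).
  - by move=> w _; rewrite -EFinM /= lee_fin.
exists M, K; split => // t tK E.
have tK1 : `|t| * K < 1 by apply: le_lt_trans tK _; lra.
pose S N w := pseries (degen_coef lambda (x - Y w)) t N.
have cvS w : S ^~ w @ \oo --> degen_exp lambda (x - Y w) t.
  exact: (is_cvg_pseries_ratio (g0 w) K0 (bound w) tK1).
have mS N : measurable_fun setT (S N).
  apply: measurable_sum => i; apply: measurable_funM => //.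
  exact: measurable_degen_coef.
have i2g : P.-integrable setT (fun w => (2 * g w)%:E).
  exact: (integrableZl measurableT 2 ig).
have absS N w : (`|(S N w)%:E| <= (2 * g w)%:E)%E.
  by rewrite lee_fin; exact: (pseries_half_ratio_le _ (g0 w) K0 (bound w) tK).
have intS N : (\int[P]_w (S N w)%:E)%E =
    (pseries (mean_degen_coef Y lambda x) t N)%:E.
  rewrite /S /pseries /series /= -sumEFin.
  under eq_integral => w _ do rewrite -sumEFin.
  rewrite integral_sum //; last first.
    move=> i; under eq_fun => w do rewrite mulrC EFinM.
    exact: (integrableZl measurableT _ (igk i)).
  apply: eq_bigr => i _; under eq_integral => w _ do rewrite EFinM.
  by rewrite integralZr ?mE ?EFinM //; exact: igk.
have cvE : EFin \o pseries (mean_degen_coef Y lambda x) t @ \oo --> E.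
  have -> : EFin \o pseries (mean_degen_coef Y lambda x) t =
      fun N => (\int[P]_w (S N w)%:E)%E.
    by apply/funext => N; rewrite intS.
  rewrite /E unlock.
  apply: (@dominated_cvg _ _ _ P setT measurableT _ _ (fun w => (2 * g w)%:E)).
  - by move=> N; apply/measurable_EFinP.
  - by move=> w _; apply: cvg_EFin; [exact: nearW|exact: cvS].
  - by [].
  - exact: i2g.
  - by move=> N w _; exact: absS.
have cvm := is_cvg_pseries_ratio M0 K0 mM tK1.
(* [E] is finite because it is also the limit of a real convergent series. *)
have -> : E = (limn (pseries (mean_degen_coef Y lambda x) t))%:E.
  apply: (cvg_unique _ cvE) => //.
  by apply: cvg_EFin; [exact: nearW|exact: cvm].
by split.
Qed.

(** * Derangement polynomials *)

Lemma has_egf_derangement_gf (R : realType) (d : measure_display)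
    (T : measurableType d) (P : probability T R) (Y : {RV P >-> R})
    (r lambda x : R) :
  0 < r -> (forall t : R, `|t| < r -> ('M_P Y t \is a fin_num)%E) ->
  has_egf (fun n => n`!%:R * \sum_(k < n.+1) mean_degen_coef Y lambda x k)
    (derangement_gf Y lambda x).
Proof.
move=> r0 mgfY.
have [M [K [K2 mM Egf]]] := expectation_degen_exp lambda x r0 mgfY.
have K0 : 0 < K by exact: lt_le_trans K2.
apply/nbhs_ballP; exists ((2 * K)^-1) => [|t] /=.
  by rewrite invr_gt0 mulr_gt0.
rewrite /ball /= sub0r normrN => tK.
have tK2 : `|t| * K <= 2^-1.
  by rewrite -ler_pdivlMr // -invfM ltW.
have [Efin Ecvg] := Egf t tK2.
split; first by rewrite /derangement_gf fin_numM.
rewrite /derangement_gf fineM //=.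
rewrite (_ : (fun n => _) =
    fun n => \sum_(k < n.+1) mean_degen_coef Y lambda x k).
  apply: (pseries_partial_sums K2 mM) => //.
  by apply: le_lt_trans tK2 _; lra.
by apply/funext => n; rewrite mulrC mulKf // pnatr_eq0 -lt0n fact_gt0.
Qed.

Lemma derangement_polyE (R : realType) (d : measure_display)
    (T : measurableType d) (P : probability T R) (Y : {RV P >-> R})
    (r lambda : R) n x :
  0 < r -> (forall t : R, `|t| < r -> ('M_P Y t \is a fin_num)%E) ->
  derangement_poly Y lambda n x =
  n`!%:R * \sum_(k < n.+1) mean_degen_coef Y lambda x k.
Proof.
move=> r0 mgfY; rewrite /derangement_poly.
by rewrite (egf_coefE (has_egf_derangement_gf _ _ r0 mgfY)).
Qed.

Lemma expectation_degen_ffact (R : realType) (d : measure_display)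
    (T : measurableType d) (P : probability T R) (Y : {RV P >-> R})
    (r lambda x : R) k :
  0 < r -> (forall t : R, `|t| < r -> ('M_P Y t \is a fin_num)%E) ->
  ('E_P[fun w => degen_ffact lambda (x - Y w) k] * (k`!%:R^-1)%:E =
   (mean_degen_coef Y lambda x k)%:E)%E.
Proof.
move=> r0 mgfY; have ik := integrable_degen_coef lambda x k r0 mgfY.
have kf : k`!%:R != 0 :> R by rewrite pnatr_eq0 -lt0n fact_gt0.
rewrite -(integral_degen_coef _ _ _ r0 mgfY) unlock.
under eq_integral => w _.
  rewrite (_ : degen_ffact _ _ _ = degen_coef lambda (x - Y w) k * k`!%:R);
    last by rewrite /degen_coef divfK.
  rewrite EFinM; over.
by rewrite integralZr // -muleA -EFinM mulfV // mule1.
Qed.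

Lemma mean_degen_coefD (R : realType) (d : measure_display)
    (T : measurableType d) (P : probability T R) (Y : {RV P >-> R})
    (r lambda x y : R) k :
  0 < r -> (forall t : R, `|t| < r -> ('M_P Y t \is a fin_num)%E) ->
  mean_degen_coef Y lambda (x + y) k =
  \sum_(j < k.+1) mean_degen_coef Y lambda x j * degen_coef lambda y (k - j).
Proof.
move=> r0 mgfY; have ik j := integrable_degen_coef lambda x j r0 mgfY.
apply: EFin_inj; rewrite -(integral_degen_coef _ _ _ r0 mgfY).
under eq_integral => w _.
  rewrite addrAC degen_coefD -sumEFin.
  under eq_bigr => j _ do rewrite EFinM.
  over.
rewrite integral_sum //; last first.
  by move=> j; exact: (integrableZr measurableT _ (ik j)).
rewrite -sumEFin; apply: eq_bigr => j _.
rewrite integralZr ?(integral_degen_coef _ _ _ r0 mgfY) ?EFinM //.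
exact: ik.
Qed.

Theorem theorem2p2 (R : realType) (d : measure_display) (T : measurableType d)
    (P : probability T R) (Y : {RV P >-> R}) (r lambda : R)
    (r_gt0 : 0 < r)
    (mgfY : forall t : R, `|t| < r -> ('M_P Y t \is a fin_num)%E)
    (lambda_neq0 : lambda != 0) (x : R) (n : nat) :
  derangement_poly Y lambda n x =
    \sum_(l < n.+1) 'C(n, l)%:R * derangement_number Y lambda l
                    * degen_ffact lambda x (n - l)
  /\
  ((derangement_poly Y lambda n x)%:E =
    (n`!%:R)%:E * \sum_(k < n.+1)
      'E_P[fun w => degen_ffact lambda (x - Y w) k] * (k`!%:R^-1)%:E)%E.
Proof.
rewrite (derangement_polyE lambda n x r_gt0 mgfY); split; last first.
  under [in RHS]eq_bigr => k _ do
    rewrite (expectation_degen_ffact lambda x k r_gt0 mgfY).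
  by rewrite sumEFin EFinM.
rewrite (eq_bigr (fun k : 'I_n.+1 => \sum_(j < k.+1)
  mean_degen_coef Y lambda 0 j * degen_coef lambda x (k - j))); last first.
  by move=> k _; rewrite -(mean_degen_coefD lambda 0 x k r_gt0 mgfY) add0r.
rewrite sum_convolution mulr_sumr; apply: eq_bigr => l _.
rewrite /derangement_number (derangement_polyE lambda l 0 r_gt0 mgfY).
have ln : (l <= n)%N by rewrite -ltnS.
have nlf : (n - l)`!%:R != 0 :> R by rewrite pnatr_eq0 -lt0n fact_gt0.
rewrite /degen_coef -(bin_fact ln) !natrM.
by field.
Qed.
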